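(* Let $X\subset\mathcal L$, $f\in X$, $n\ge1$, $\alpha\in(0,1)$, and let $Y_i=f\left(\frac{i-1}{n}\right)+\epsilon_i$, $i=1,\dots,n$, where $\epsilon_1,\dots,\epsilon_n$ are independent real random variables with mean zero such that for some $\kappa>0$, $v>0$ and all integers $m\ge2$ one has $\mathbb E|\epsilon_i|^m\le v\,m!\,\kappa^{m-2}/2$ for all $i$. Let $k\in\mathbb N_0$ be such that $f^{(n)}\in X_k^{(n)}$. Then $$\mathbb P\left(k_{\tau_n(\alpha)}(Y^{(n)})<k_{2\tau_n(\alpha)}(f^{(n)})\right)\le\alpha .$$
   Context: $\mathcal L^\infty$ is the space of Lebesgue-measurable essentially bounded functions $[0,1]\to\mathbb R$ (genuine functions, not equivalence classes). With $t^-(\delta)=\max(0,t-\delta)$, $t^+(\delta)=\min(1,t+\delta)$, let $\mathcal L$ be the set of $f\in\mathcal L^\infty$ with $f(t)=\lim_{\epsilon\to0}\inf_{0<\delta<\epsilon}\frac{1}{t^+(\delta)-t^-(\delta)}\int_{t^-(\delta)}^{t^+(\delta)}f(s)\,ds$ for all $t\in[0,1]$ (each a.e.-class in $\mathcal L^\infty$ has exactly one representative in $\mathcal L$). The Kolmogorov distance is $d_K(f,g)=\sup_{x\in[0,1]}\left|\int_0^x (f(s)-g(s))\,ds\right|$. Number of modes: for $g:[0,1]\to\mathbb R$ and a partition $P$: $0=t_0<\dots<t_{N}=1$, let $M(g,P)$ be the number of indices $0<i<N$ with $\max(g(t_{i-1}),g(t_{i+1}))<g(t_i)$, and let $M(g)=\sup_P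 M(g,P)$ over all finite partitions. For $n\ge1$ let $PC_n$ be the set of $g\in\mathcal L$ that are constant on each open interval $\left(\frac{i-1}{n},\frac in\right)$, $i=1,\dots,n$. Let $X^{(n)}_j=\{g\in PC_n: M(g)\le j\}$, and for $g\in PC_n$ let $s_j(g)=\inf_{h\in X_j^{(n)}}d_K(g,h)$, $j\in\mathbb N_0$, and $s_{-1}(g)=\infty$. Let $f^{(n)}\in PC_n$ be the function with value $f\left(\frac{i-1}{n}\right)$ on $\left(\frac{i-1}{n},\frac in\right)$, and $Y^{(n)}\in PC_n$ the (random) function with value $Y_i$ on $\left(\frac{i-1}{n},\frac in\right)$, $i=1,\dots,n$. For $\epsilon>0$ and $g\in PC_n$: $k_\epsilon(g)=\max\{j\in\mathbb N_0: s_{j-1}(g)\ge\epsilon\}$. The threshold is $\tau_n(\alpha)=\frac1n\left(\sqrt{\log(\alpha/2)\left(\log(\alpha/2)\kappa^2-2nv\right)}-\kappa\log(\alpha/2)\right)$. *)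

(* Defs.v *)
From HB Require Import structures.
From mathcomp Require Import all_boot all_order all_algebra.
From mathcomp Require Import all_classical all_reals all_analysis.

Set Implicit Arguments.
Unset Strict Implicit.
Unset Printing Implicit Defensive.

Import Order.TTheory GRing.Theory Num.Theory.
Import numFieldNormedType.Exports.

Local Open Scope classical_set_scope.
Local Open Scope ring_scope.

(* Functions [0,1] -> R are represented by total functions R -> R; none of the
   notions below depends on the values taken outside [0,1] (in particular,
   elements of the function classes below are only determined on [0,1]). *)

(* R with the sigma-algebra of Lebesgue-measurable (not only Borel) sets, i.e.,
   the domain of the completed Lebesgue measure. *)
Notation lebesgueType R := (caratheodory_type (@wlength R idfun)^*%mu).

Section function_spaces.
Context {R : realType}.
Implicit Types (f g h : R -> R) (n j : nat) (t x e : R).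

Local Notation mu := (@completed_lebesgue_measure R).

Definition Linfty f : Prop :=
  measurable_fun (`[0, 1] : set (lebesgueType R)) (f : lebesgueType R -> R) /\
  exists M : R, {ae mu, forall t : R, 0 <= t <= 1 -> `|f t| <= M}.

Definition tminus t d : R := Num.max 0 (t - d).
Definition tplus t d : R := Num.min 1 (t + d).

Definition local_avg f t d : R :=
  (tplus t d - tminus t d)^-1 * \int[mu]_(s in `[tminus t d, tplus t d]) f s.

Definition calL : set (R -> R) := [set f | Linfty f /\
  forall t, 0 <= t <= 1 ->
    ereal_inf [set (local_avg f t d)%:E | d in `]0, e[] @[e --> 0^'+]
      --> (f t)%:E].

Definition dK f g : \bar R :=
  ereal_sup [set (`| \int[mu]_(s in `[0, x]) (f s - g s) |)%:E
            | x in `[0, 1]].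

(* The partition 0 = t_0 < ... < t_N = 1 is encoded by s = [:: t_1; ...; t_N],
   with itv_partition 0 1 s. *)
Definition modes_on g (s : seq R) : nat :=
  let t := 0 :: s in
  (\sum_(1 <= i < size s)
     (Num.max (g (nth 0 t i.-1)) (g (nth 0 t i.+1)) < g (nth 0 t i))%R)%N.

Definition modes g : \bar R :=
  ereal_sup [set (modes_on g s)%:R%:E | s in itv_partition 0 1].

(* The i-th open interval, numbered from 0. *)
Definition cell n (i : 'I_n) : set R := `]i%:R / n%:R, i.+1%:R / n%:R[.

Definition PC n : set (R -> R) := [set g | calL g /\
  forall i : 'I_n, exists c : R, forall t, cell i t -> g t = c].

(* The element of PC n with prescribed values on the n open intervals; it exists
   for n >= 1 and is unique on [0,1], since elements of calL are determined by
   their a.e. class. *)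
Definition pcfun n (a : 'I_n -> R) : R -> R :=
  get [set g | PC n g /\ forall (i : 'I_n) t, cell i t -> g t = a i].

Definition X_ n j : set (R -> R) :=
  [set g | PC n g /\ (modes g <= j%:R%:E)%E].

Definition s_ n j g : \bar R := ereal_inf [set dK g h | h in X_ n j].

(* s_pred n j g is s_{j-1}(g), with s_{-1}(g) = +oo. *)
Definition s_pred n j g : \bar R :=
  if j is j'.+1 then s_ n j' g else +oo%E.

(* The maximum of { j | s_{j-1}(g) >= e }, a set which contains 0 and, for e > 0
   and g in PC n, is bounded. *)
Definition k_ n e g : nat :=
  let A := [set j : nat | (e%:E <= s_pred n j g)%E] in
  get (A `&` [set j | forall i, A i -> (i <= j)%N]).

Definition tau n (kappa v alpha : R) : R :=
  n%:R^-1 *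
  (Num.sqrt (ln (alpha / 2) *
             (ln (alpha / 2) * kappa ^+ 2 - 2 * n%:R * v))
   - kappa * ln (alpha / 2)).

End function_spaces.

Definition mutually_independent (d : measure_display) (T : measurableType d)
    (R : realType) (P : probability T R) (I : finType)
    (X : I -> {RV P >-> R}) : Prop :=
  forall (J : {set I}) (A : I -> set R), (forall i, measurable (A i)) ->
    P (\bigcap_(i in [set` J]) X i @^-1` A i) =
    (\prod_(i in J) P (X i @^-1` A i))%E.

(* Main.v *)
(* On the event that all partial sums S_m of the noise satisfy
   |S_m| <= n tau_n, the Kolmogorov distance of Y^(n) and f^(n) is at most tau_n,
   because x |-> \int_0^x (Y^(n) - f^(n)) interpolates the points (m/n, S_m/n)
   linearly.  Each s_j is 1-Lipschitz for d_K, so s_{K-1}(f^(n)) >= 2 tau_n then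
   forces s_{K-1}(Y^(n)) >= tau_n.  The event fails with probability at most
   alpha by Bernstein's inequality in its maximal form: exp(lam S_m - m c) is a
   nonnegative supermartingale as soon as the moment generating functions are at
   most exp c, and tau_n solves x^2 / (2 (n v + kappa x)) = - ln (alpha / 2),
   x = n tau_n. *)

Require Import Defs.
From HB Require Import structures.
From mathcomp Require Import all_boot all_order all_algebra.
From mathcomp Require Import all_classical all_reals all_analysis.
From mathcomp Require Import measurable_realfun zify ring lra.

Set Implicit Arguments.
Unset Strict Implicit.
Unset Printing Implicit Defensive.

Import Order.TTheory GRing.Theory Num.Theory.
Import numFieldNormedType.Exports.

Local Open Scope classical_set_scope.
Local Open Scope ring_scope.

(** * Independence and Bernstein's maximal inequality *)

(** The supermartingale is handled without conditional expectations or stopping times: the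
    exponential is multiplied by the indicator that the level has not been crossed yet, which leaves
    a function of the past, and independence of the past and the next variable is applied to
    products. The two signs of [lam] account for the two halves of [alpha]. Two notions are defined
    by choice and say nothing until existence is shown. For [pcfun] the witness takes at each jump
    the midpoint of the one-sided limits, the value that symmetric averages select. For [k_] the set
    of indices must be bounded, which holds because a function constant on n cells has at most 2n
    modes. The event must also be measurable, although s_j is an infimum over uncountably many
    functions; this follows from its Lipschitz dependence on the n cell values. *)

Lemma measurable_preT (d d' : measure_display) (T : measurableType d)
    (T' : measurableType d') (f : T -> T') (B : set T') :
  measurable_fun setT f -> measurable B -> measurable (f @^-1` B).
Proof. by move=> mf mB; rewrite -[X in measurable X]setTI; exact: mf. Qed.

(** By independence the law of (F, H) and the product of the marginal laws agree on rectangles,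
    hence everywhere; Tonelli then splits the integral. *)
Lemma ge0_integral_prod_independent (d : measure_display)
    (T : measurableType d) (R : realType) (P : probability T R) (F H : T -> R) :
  measurable_fun setT F -> measurable_fun setT H ->
  (forall w, 0 <= F w) -> (forall w, 0 <= H w) ->
  (forall A B, measurable A -> measurable B ->
     P ((F @^-1` A) `&` (H @^-1` B)) = (P (F @^-1` A) * P (H @^-1` B))%E) ->
  (\int[P]_w (F w * H w)%:E = (\int[P]_w (F w)%:E) * (\int[P]_w (H w)%:E))%E.
Proof.
move=> mF mH F0 H0 FH.
pose F' : {RV P >-> R} := HB.pack F (isMeasurableFun.Build _ _ _ _ F mF).
pose H' : {RV P >-> R} := HB.pack H (isMeasurableFun.Build _ _ _ _ H mH).
have mFH : measurable_fun setT (fun w => (F w, H w)) by exact: measurable_fun_pair.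
pose K (w : T) := (F w, H w).
pose FH' : {mfun T >-> (R * R)%type} := HB.pack K (isMeasurableFun.Build _ _ _ _ K mFH).
have e X : measurable X ->
    (distribution P F' \x distribution P H')%E X = pushforward P FH' X.
  apply: product_measure_unique => A B mA mB.
  exact: FH.
(* The absolute values make the integrand nonnegative on the whole plane, as Tonelli asks, and
   change nothing on the range of [F] and [H]. *)
pose f (z : R * R) : \bar R := (`|z.1| * `|z.2|)%:E.
have mf : measurable_fun [set: R * R] f.
  apply/measurable_EFinP; apply: measurable_funM; exact: measurableT_comp.
have f0 z : (0 <= f z)%E by rewrite lee_fin mulr_ge0.
transitivity (\int[pushforward P FH']_z f z)%E.
  rewrite ge0_integral_pushforward//.
  by apply: eq_integral => w _; rewrite /f/= !ger0_norm.
transitivity (\int[(distribution P F' \x distribution P H')%E]_z f z)%E.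
  by apply: eq_measure_integral => A mA _; exact: (esym (e A mA)).
have mn : measurable_fun [set: R] (fun x : R => `|x|%:E).
  apply/measurable_EFinP. exact: normr_measurable.
rewrite fubini_tonelli1//.
rewrite /fubini_F /=.
transitivity (\int[distribution P F']_x (`|x|%:E * \int[distribution P H']_y (`|y|%:E)))%E.
  apply: eq_integral => x _ /=; rewrite -ge0_integralZl//.
have HE : (\int[distribution P H']_y (`|y|%:E) = \int[P]_w (H w)%:E)%E.
  rewrite ge0_integral_pushforward//.
  by apply: eq_integral => w _ /=; rewrite ger0_norm.
rewrite HE ge0_integralZr//; last first.
  by apply: integral_ge0 => w _; rewrite lee_fin.
congr (_ * _)%E.
rewrite ge0_integral_pushforward//.
by apply: eq_integral => w _ /=; rewrite ger0_norm.
Qed.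

(** A pi-system generating the sigma-algebra of the first [k] variables. *)
Definition past_cylinders (d : measure_display) (T : measurableType d)
    (R : realType) (P : probability T R) (n : nat) (X : 'I_n -> {RV P >-> R})
    (k : nat) : set (set T) :=
  [set E | exists2 A : 'I_n -> set R, (forall i, measurable (A i)) &
     E = \bigcap_(i in [set i : 'I_n | (i < k)%N]) (X i @^-1` A i)].

(** Both sides are finite measures in [E] that agree on cylinders, hence on the sigma-algebra
    generated by them. *)
Lemma past_independent (d : measure_display) (T : measurableType d)
    (R : realType) (P : probability T R) (n : nat) (X : 'I_n -> {RV P >-> R})
    (k : 'I_n) (E : set T) (B : set R) :
  mutually_independent X -> <<s past_cylinders X k >> E -> measurable B ->
  P (E `&` (X k @^-1` B)) = (P E * P (X k @^-1` B))%E.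
Proof.
move=> indX sE mB.
have mXB : measurable (X k @^-1` B) by exact: measurable_preT.
have r0 : 0 <= fine (P (X k @^-1` B)) by exact: fine_ge0.
pose r : {nonneg R} := NngNum r0.
have rE : (r%:num%:E = P (X k @^-1` B))%E by rewrite /= fineK// fin_num_measure.
rewrite -rE muleC.
apply: (g_sigma_algebra_measure_unique (past_cylinders X k) _ (fun=> setT) _ _
  (mrestr P mXB) (mscale r P)) => //.
- move=> _ [A mA ->]; apply: fin_bigcap_measurable => // i _.
  by exact: measurable_preT.
- by move=> _; exists (fun=> setT) => //; apply/esym; rewrite -subTset => ? _ i _.
- by rewrite bigcup_const.
- move=> _ _ [A mA ->] [A' mA' ->]; exists (fun i => A i `&` A' i).
    by move=> i; exact: measurableI.
  by rewrite -bigcapI.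
- move=> _ [A mA ->]; rewrite /mrestr.
  rewrite [RHS](_ : _ = r%:num%:E *
    P (\bigcap_(i in [set i : 'I_n | (i < k)%N]) (X i @^-1` A i)))%E// rE muleC.
  (* Intersecting a past cylinder with the event on [X k] gives a cylinder over one more coordinate;
     the product formula is used for both index sets. *)
  pose A' i := if i == k then B else A i.
  have mA' i : measurable (A' i) by rewrite /A'; case: ifP.
  have := indX ([set i : 'I_n | (i < k)%N])%SET A mA.
  have := indX (k |: [set i : 'I_n | (i < k)%N])%SET A' mA'.
  rewrite big_setU1/= ?inE ?ltnn// /A' eqxx.
  under [X in (_ * X)%E]eq_bigr => i.
    rewrite inE => ik; have -> : (i == k) = false.
      by apply: contraTF ik => /eqP ->; rewrite ltnn.
    over.
  move=> H1 H2; rewrite muleC.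
  rewrite [X in P X = _](_ : _ = \bigcap_(i in [set` (k |: [set i : 'I_n | (i < k)%N])%SET])
    X i @^-1` (if i == k then B else A i)).
    rewrite H1 -H2.
    rewrite (_ : [set` [set i : 'I_n | (i < k)%N]%SET] = [set i : 'I_n | (i < k)%N])//.
    by apply/seteqP; split => i /=; rewrite inE.
  apply/seteqP; split => w /=.
    move=> [wA wB] i /=; rewrite !inE => /orP[/eqP ->|ik]; first by rewrite eqxx.
    by case: eqP => [->//|_]; exact: wA.
  move=> wA; split; last by have := wA k; rewrite /= !inE !eqxx; exact.
  move=> i /= ik; have := wA i; rewrite /= !inE ik orbT.
  by case: eqP ik => [->|_ _]; [rewrite ltnn|exact].
- by move=> _; rewrite /mrestr /= (le_lt_trans (probability_le1 _ _)) ?ltry//; exact: measurableI.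
Qed.

(** * The exponential process killed at a crossing *)

Section stopped_walk.
Context {R : realType} {d0 : measure_display} {T0 : measurableType d0}.
Variables (n : nat) (X : 'I_n -> T0 -> R) (lam y c : R).

(** The space [T0] is arbitrary and the [X i] are plain functions because the measurability lemmas
    of this section serve twice: for [T] itself and for [T] with the sigma-algebra of the past,
    where only the first [k] coordinates are known to be measurable. *)
Definition walk (j : nat) (w : T0) : R := \sum_(i < n | (i < j)%N) X i w.

Definition walk_below (j : nat) : set T0 :=
  [set w | forall i : nat, (i <= j)%N -> lam * walk i w <= y].

(** The indicator kills the process at the first crossing; [j%:R * c] compensates the growth of the
    exponential moments. *)
Definition exp_walk_below (j : nat) (w : T0) : R :=
  expR (lam * walk j w - j%:R * c) * \1_(walk_below j) w.

Lemma walkS (j : 'I_n) (w : T0) : walk j.+1 w = walk j w + X j w.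
Proof.
rewrite /walk (bigD1 j)/= ?leqnn// addrC; congr (_ + _).
apply: eq_bigl => i; rewrite ltnS ltn_neqAle andbC; congr andb.
Qed.

Lemma walk0 (w : T0) : walk 0 w = 0. Proof. exact: big_pred0_eq. Qed.

Variable k : nat.
Hypothesis mX : forall i : 'I_n, (i < k)%N -> measurable_fun setT (X i).

Lemma measurable_walk (j : nat) : (j <= k)%N -> measurable_fun setT (walk j).
Proof.
move=> jk.
rewrite (_ : walk j = fun w => \sum_(i < n) (if (i < j)%N then X i w else 0)); last first.
  by apply/funext => w; rewrite /walk big_mkcond.
apply: measurable_sum => i; case: (boolP (i < j)%N) => [ij|_]; last exact: measurable_cst.
exact/mX/(leq_trans ij).
Qed.

Lemma measurable_walk_below (j : nat) : (j <= k)%N -> measurable (walk_below j).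
Proof.
move=> jk.
rewrite (_ : walk_below j = \bigcap_(i in `I_j.+1) [set w | lam * walk i w <= y]).
  apply: fin_bigcap_measurable => // i /=; rewrite ltnS => ij.
  rewrite (_ : mkset _ = (fun w => lam * walk i w) @^-1` `]-oo, y]).
    rewrite -[X in measurable X]setTI.
    have mlw : measurable_fun setT (fun w => lam * walk i w).
      by apply: measurable_funM => //; apply: measurable_walk; exact: leq_trans jk.
    exact: mlw.
  by apply/seteqP; split => w /=; rewrite in_itv.
by apply/seteqP; split => w.
Qed.

Lemma measurable_exp_walk_below (j : nat) : (j <= k)%N ->
  measurable_fun setT (exp_walk_below j).
Proof.
move=> jk; apply: measurable_funM.
  apply: measurableT_comp => //; apply: measurable_funB => //.
  by apply: measurable_funM => //; exact: measurable_walk.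
exact/measurable_indic/measurable_walk_below.
Qed.

End stopped_walk.

Lemma past_measurable_coord (d : measure_display) (T : measurableType d)
    (R : realType) (P : probability T R) (n : nat) (X : 'I_n -> {RV P >-> R})
    (k : nat) (i : 'I_n) : (i < k)%N ->
  measurable_fun [set: g_sigma_algebraType (past_cylinders X k)]
    (X i : g_sigma_algebraType (past_cylinders X k) -> R).
Proof.
move=> ik _ B mB; rewrite setTI; apply: sub_sigma_algebra.
exists (fun j => if j == i then B else setT).
  by move=> j; case: ifP.
apply/seteqP; split => w /= => [Bw j jk|/(_ i ik)]; last by rewrite eqxx.
by case: eqP => [->|].
Qed.

Lemma exp_maximal_inequality (d : measure_display) (T : measurableType d)
    (R : realType) (P : probability T R) (n : nat) (X : 'I_n -> {RV P >-> R})
    (lam c y : R) :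
  mutually_independent X -> 0 <= c -> 0 <= y ->
  (forall i, (\int[P]_w (expR (lam * X i w))%:E <= (expR c)%:E)%E) ->
  (P (~` walk_below X lam y n) <= (expR (n%:R * c - y))%:E)%E.
Proof.
move=> indX c0 y0 mgf.
have mX k (i : 'I_n) : (i < k)%N -> measurable_fun setT (X i) by [].
(* W j = V j + a 1_{walk has crossed the level} has nonincreasing expectation,
   and a P(crossed before n) <= E (W n) <= E (W 0) = 1. *)
pose V j w := exp_walk_below X lam y c j w.
pose a := expR (y - n%:R * c).
pose A j := walk_below X lam y j.
pose W j w := V j w + a * \1_(~` A j) w.
have mA j : measurable (A j) by exact: (measurable_walk_below lam y (mX j)).
have mV j : measurable_fun setT (V j).
  exact: (measurable_exp_walk_below lam y c (mX j)).
have V0 j w : 0 <= V j w by rewrite mulr_ge0// expR_ge0.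
have a0 : 0 <= a by exact: expR_ge0.
have mB j : measurable_fun setT (fun w => a * \1_(~` A j) w : R).
  by apply: measurable_funM => //; apply: measurable_indic; exact: measurableC.
have B0 j w : 0 <= a * \1_(~` A j) w by rewrite mulr_ge0.
have mW j : measurable_fun setT (W j) by exact: measurable_funD.
have intB j : (\int[P]_w (a * \1_(~` A j) w)%:E = a%:E * P (~` A j))%E.
  under eq_integral do rewrite EFinM.
  rewrite ge0_integralZl_EFin//.
  - by rewrite integral_indic ?setIT//; exact: measurableC.
  - by apply/measurable_EFinP; apply: measurable_indic; exact: measurableC.
have intW j : (\int[P]_w (W j w)%:E = \int[P]_w (V j w)%:E + a%:E * P (~` A j))%E.
  under eq_integral do rewrite /W EFinD.
  by rewrite ge0_integralD//= ?intB//; [move=> *; rewrite lee_fin|exact/measurable_EFinP|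
    move=> *; rewrite lee_fin|exact/measurable_EFinP].
pose H (j : 'I_n) w := expR (lam * X j w - c).
have mH j : measurable_fun setT (H j).
  apply: measurableT_comp => //; apply: measurable_funB => //.
  exact: measurable_funM.
have H0 j w : 0 <= H j w by exact: expR_ge0.
have intH j : (\int[P]_w (H j w)%:E <= 1)%E.
  under eq_integral do rewrite /H expRD mulrC EFinM.
  rewrite ge0_integralZl_EFin ?expR_ge0//.
  - rewrite (@le_trans _ _ ((expR (- c))%:E * (expR c)%:E)%E)//.
      by apply: lee_wpmul2l => //; rewrite lee_fin expR_ge0.
    by rewrite -EFinM -expRD addNr expR0.
  - apply/measurable_EFinP; apply: measurableT_comp => //.
    exact: measurable_funM.
have step (j : 'I_n) : (\int[P]_w (W j.+1 w)%:E <= \int[P]_w (W j w)%:E)%E.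
  apply: (@le_trans _ _ (\int[P]_w ((V j w * H j w) + a * \1_(~` A j) w)%:E)%E).
    apply: ge0_le_integral => //.
    - by move=> w _; rewrite lee_fin; exact: addr_ge0.
    - exact/measurable_EFinP.
    - apply/measurable_EFinP; apply: measurable_funD => //.
      exact: measurable_funM.
    move=> w _; rewrite lee_fin /W /V /exp_walk_below /H.
    have [Aw|nAw] := pselect (A j.+1 w).
      have Ajw : A j w by move=> i ij; apply: Aw; exact: leqW.
      have nnA : ~ (~` A j.+1) w by apply.
      have nnAj : ~ (~` A j) w by apply.
      rewrite !indicE (mem_set Aw) (mem_set Ajw) (memNset nnA) (memNset nnAj).
      rewrite !mulr0 !addr0 !mulr1 -expRD walkS ler_expR -natr1.
      by rewrite le_eqVlt; apply/orP; left; apply/eqP; ring.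
    (* After an earlier crossing both sides equal [a]. If the crossing happens exactly at time
       [j.+1], then [V j w * H j w] is the exponential at that time, which is at least [a] since the
       level [y] is exceeded and [j.+1%:R * c <= n%:R * c]. *)
    rewrite !indicE (memNset nAw) (mem_set (nAw : (~` A j.+1) w)) mulr0 add0r mulr1.
    have [Ajw|nAjw] := pselect (A j w); last first.
      by rewrite (memNset nAjw) (mem_set (nAjw : (~` A j) w)) mulr0 mul0r add0r mulr1.
    have nnAj : ~ (~` A j) w by apply.
    rewrite (mem_set Ajw) (memNset nnAj).
    rewrite mulr1 mulr0 addr0 -expRD ler_expR.
    have : y < lam * walk X j.+1 w.
      rewrite ltNge; apply/negP => h; apply: nAw => i.
      rewrite leq_eqVlt ltnS => /predU1P[->//|].
      exact: Ajw.
    rewrite walkS => yS.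
    have jn : j.+1%:R * c <= n%:R * c by rewrite ler_wpM2r// ler_nat.
    rewrite -natr1 in jn; lra.
  rewrite [leLHS](_ : _ = \int[P]_w (V j w * H j w)%:E + a%:E * P (~` A j))%E; last first.
    under eq_integral do rewrite EFinD.
    rewrite ge0_integralD//= ?intB//.
    + by move=> *; rewrite lee_fin; exact: mulr_ge0.
    + by apply/measurable_EFinP; exact: measurable_funM.
    + by move=> *; rewrite lee_fin.
    + exact/measurable_EFinP.
  rewrite intW; apply: leeD => //.
  (* [V j] depends on the past and [H j] on [X j] alone, so the expectation factors, and the second
     factor is at most 1. *)
  rewrite ge0_integral_prod_independent//.
    rewrite -[leRHS]mule1; apply: lee_pmul => //;
      by apply: integral_ge0 => w _; rewrite lee_fin.
  move=> B C mB' mC.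
  have -> : H j @^-1` C = X j @^-1` [set z | C (expR (lam * z - c))] by [].
  apply: past_independent => //.
    have := measurable_exp_walk_below lam y c (@past_measurable_coord _ _ _ _ _ X j) (leqnn j).
    by move=> mVp; exact: (measurable_preT mVp mB').
  apply: (@measurable_preT _ _ _ _ (fun z : R => expR (lam * z - c))) => //.
  by apply: measurableT_comp => //; exact: measurable_funB.
have main j : (j <= n)%N -> (\int[P]_w (W j w)%:E <= 1)%E.
  elim: j => [_|j IH jn].
    have A0 w : A 0 w by move=> i; rewrite leqn0 => /eqP ->; rewrite walk0 mulr0.
    have nA0 w : ~ (~` A 0) w by apply.
    under eq_integral => w _.
      rewrite /W /V /exp_walk_below !indicE (mem_set (A0 w)) (memNset (nA0 w)).
      rewrite walk0 mulr0 mul0r subrr expR0 mulr1 mulr0 addr0; over.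
    by rewrite integral_cst// mul1e probability_le1.
  exact: le_trans (step (Ordinal jn)) (IH (ltnW jn)).
have := main n (leqnn n); rewrite intW => h.
have : (a%:E * P (~` A n) <= 1)%E.
  by apply: le_trans h; rewrite leeDr//; apply: integral_ge0 => w _; rewrite lee_fin.
rewrite -lee_pdivlMl ?expR_gt0// mule1 -expRN opprB.
exact.
Qed.

(** Absolute values enter only from order 2 on, so that the linear term keeps its sign and can
    vanish in the mean. An extended-real series can be integrated termwise with no prior
    summability. *)
Lemma expR_le_quadratic_series (R : realType) (u : R) :
  ((expR u)%:E <= (1 + u)%:E + \sum_(m <oo) (`|u| ^+ m.+2 / (m.+2)`!%:R)%:E)%E.
Proof.
set Z := (\sum_(m <oo) _)%E.
have Z0 : (0 <= Z)%E by apply: nneseries_ge0 => m _ _; rewrite lee_fin divr_ge0.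
have ZN N : ((\sum_(0 <= m < N) `|u| ^+ m.+2 / (m.+2)`!%:R)%:E <= Z)%E.
  rewrite -sumEFin; apply: nneseries_lim_ge => m _ _.
  by rewrite lee_fin divr_ge0.
case: Z Z0 ZN => [z||]// z0 zN; last by rewrite addey// leey.
rewrite -EFinD lee_fin /expR.
apply: limr_le; first exact: is_cvg_series_exp_coeff.
exists 2%N => // -[|[|M]]//= _.
rewrite /series/= big_nat_recl// big_nat_recl// addrA; apply: lerD.
  by rewrite /exp_coeff/= expr0 expr1 !divr1.
have := zN M; rewrite lee_fin; apply: le_trans; apply: ler_sum => m _.
rewrite /exp_coeff/= ler_pM2r ?invr_gt0 ?ltr0n ?fact_gt0//.
by rewrite -normrX ler_norm.
Qed.

(** The factorials of the moment bounds cancel those of the exponential series, leaving a geometric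
    series of ratio [|lam| * kappa]. The linear term has mean zero, and 1 + b <= exp b concludes. *)
Lemma bernstein_mgf (d : measure_display) (T : measurableType d)
    (R : realType) (P : probability T R) (X : {RV P >-> R}) (lam kappa v : R) :
  0 <= kappa -> 0 <= v -> `|lam| * kappa < 1 -> ('E_P[X] = 0)%E ->
  (forall m : nat, (2 <= m)%N ->
       ('E_P[fun w => (`|X w| ^+ m)%R]
         <= (v * m`!%:R * kappa ^+ (m - 2) / 2)%:E)%E) ->
  (\int[P]_w (expR (lam * X w))%:E
     <= (expR (lam ^+ 2 * v / 2 / (1 - `|lam| * kappa)))%:E)%E.
Proof.
move=> k0 v0 lk mean mom.
rewrite unlock in mean.
have {}mom m : (\int[P]_w (`|X w| ^+ m.+2)%:E <= (v * (m.+2)`!%:R * kappa ^+ m / 2)%:E)%E.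
  by have := mom m.+2 isT; rewrite unlock !subSS subn0.
have mXm m : measurable_fun setT (fun w => `|X w| ^+ m).
  by apply: measurable_funX; exact: measurableT_comp.
(* Splitting off the linear term needs integrability, which the second moment gives through |x| <= 1
   + x^2. *)
have intX : P.-integrable setT (EFin \o X).
  apply: (@le_integrable _ _ _ _ _ _ _ (fun w => (1 + `|X w| ^+ 2)%:E)) => //.
  - exact/measurable_EFinP.
  - move=> w _ /=; rewrite lee_fin [leRHS]ger0_norm ?addr_ge0//.
    have := sqr_ge0 (`|X w| - 1/2); rewrite !expr2 => h; nra.
  - apply/integrableP; split.
      by apply/measurable_EFinP; apply: measurable_funD => //; exact: mXm.
    under eq_integral => w _ do rewrite gee0_abs ?lee_fin ?addr_ge0// EFinD.
    rewrite ge0_integralD//; last exact/measurable_EFinP/mXm.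
    rewrite lte_add_pinfty//.
      by rewrite integral_cst// mul1e (le_lt_trans (probability_le1 _ _))// ltry.
    by rewrite (le_lt_trans (mom 0%N))// ltry.
pose g m w : \bar R := (`|lam * X w| ^+ m.+2 / (m.+2)`!%:R)%:E.
pose Z w : \bar R := (\sum_(m <oo) g m w)%E.
have g0 m w : (0 <= g m w)%E by rewrite lee_fin divr_ge0.
have mg m : measurable_fun setT (g m).
  apply/measurable_EFinP; apply: measurable_funM => //; apply: measurable_funX.
  by apply: measurableT_comp => //; exact: measurable_funM.
have Z0 w : (0 <= Z w)%E by exact: nneseries_ge0.
have mZ : measurable_fun setT Z by exact: ge0_emeasurable_sum.
set b := lam ^+ 2 * v / 2 / (1 - `|lam| * kappa).
have intZ : (\int[P]_w Z w <= b%:E)%E.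
  rewrite /Z integral_nneseries//.
  have gE m : (\int[P]_w g m w <= ((lam ^+ 2 * v / 2) * (`|lam| * kappa) ^+ m)%:E)%E.
    under eq_integral => w _.
      rewrite /g normrM exprMn mulrAC EFinM; over.
    rewrite ge0_integralZl_EFin//; last exact/measurable_EFinP/mXm.
    apply: le_trans (lee_wpmul2l _ (mom m)) _; first by rewrite lee_fin divr_ge0.
    rewrite -EFinM lee_fin le_eqVlt; apply/orP; left; apply/eqP.
    rewrite -(real_normK (num_real lam)) exprS exprS exprMn.
    have f0 : (m.+2)`!%:R != 0 :> R by rewrite pnatr_eq0 -lt0n fact_gt0.
    by field.
  apply: (@le_trans _ _ (\sum_(m <oo) ((lam ^+ 2 * v / 2) * (`|lam| * kappa) ^+ m)%:E)%E).
    by apply: lee_nneseries => // m _ _; exact: integral_ge0.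
  apply: lime_le.
    apply: is_cvg_nneseries => m _ _; rewrite lee_fin mulr_ge0//.
      by rewrite divr_ge0// mulr_ge0// sqr_ge0.
    by rewrite exprn_ge0// mulr_ge0.
  apply: nearW => N; rewrite sumEFin lee_fin.
  have := @geometric_seriesE R (lam ^+ 2 * v / 2) (`|lam| * kappa) (negbT (lt_eqF lk)).
  move=> /(congr1 (fun f => f N)); rewrite /series/geometric/= => ->.
  rewrite /b ler_pM2r ?invr_gt0 ?subr_gt0//.
  rewrite -[leRHS]mulr1; apply: ler_wpM2l.
    by rewrite divr_ge0// mulr_ge0// sqr_ge0.
  by rewrite gerBl exprn_ge0// mulr_ge0.
apply: (@le_trans _ _ (\int[P]_w ((1 + lam * X w)%:E + Z w))%E).
  apply: ge0_le_integral => //.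
  - apply/measurable_EFinP; apply: measurableT_comp => //; exact: measurable_funM.
  - apply: emeasurable_funD => //; apply/measurable_EFinP.
    by apply: measurable_funD => //; exact: measurable_funM.
  - by move=> w _; exact: expR_le_quadratic_series.
have intl : P.-integrable setT (fun w => (1 + lam * X w)%:E).
  have := integrableD measurableT (finite_measure_integrable_cst P 1 measurableT)
    (integrableZl measurableT lam intX).
  by apply: eq_integrable.
rewrite integralD//=; last first.
  apply/integrableP; split => //.
  under eq_integral => w _ do rewrite gee0_abs//.
  by rewrite (le_lt_trans intZ)// ltry.
apply: (@le_trans _ _ (1 + b%:E)%E).
  apply: leeD => //.
  under eq_integral => w _ do rewrite EFinD EFinM.
  rewrite integralD//=; last 2 first.
  - exact: (finite_measure_integrable_cst P 1 measurableT).
  - exact: integrableZl.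
  rewrite integralZl// mean mule0 adde0 integral_cst// mul1e.
  exact: probability_le1.
by rewrite -EFinD lee_fin expR_ge1Dx.
Qed.

(** With l = ln (alpha / 2) < 0, [x] is the larger root of x^2 + 2 kappa l x + 2 l n v = 0, and the
    sign of l makes the radicand nonnegative. *)
Lemma tau_quadratic (R : realType) (n : nat) (kappa v alpha : R) :
  (1 <= n)%N -> 0 < alpha < 1 -> 0 < kappa -> 0 < v ->
  let x := n%:R * tau n kappa v alpha in
  0 < x /\ x ^+ 2 = - ln (alpha / 2) * (2 * (n%:R * v + kappa * x)).
Proof.
move=> n1 /andP[a0 a1] k0 v0 x.
have n0 : 0 < n%:R :> R by rewrite ltr0n.
set l := ln (alpha / 2).
have l0 : l < 0.
  apply: ln_lt0; rewrite divr_gt0//= ltr_pdivrMr// mul1r.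
  by rewrite (lt_trans a1)// ltr1n.
have -> : x = Num.sqrt (l * (l * kappa ^+ 2 - 2 * n%:R * v)) - kappa * l.
  by rewrite /x /tau mulrA divff ?mul1r// gt_eqF.
set s := Num.sqrt _.
have arg0 : 0 <= l * (l * kappa ^+ 2 - 2 * n%:R * v).
  have -> : l * (l * kappa ^+ 2 - 2 * n%:R * v) = (l * kappa) ^+ 2 + - l * (2 * n%:R * v) by ring.
  by rewrite addr_ge0 ?sqr_ge0// !mulr_ge0// ltW// oppr_gt0.
have s2 : s ^+ 2 = l * (l * kappa ^+ 2 - 2 * n%:R * v) by rewrite sqr_sqrtr.
have kl : kappa * l < 0 by rewrite pmulr_rlt0.
split.
  by have : 0 <= s := sqrtr_ge0 _; move: kl; lra.
transitivity (s ^+ 2 - 2 * kappa * l * s + kappa ^+ 2 * l ^+ 2); first by ring.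
by rewrite s2; ring.
Qed.

Lemma bernstein_maximal (d : measure_display) (T : measurableType d)
    (R : realType) (P : probability T R) (n : nat) (X : 'I_n -> {RV P >-> R})
    (kappa v alpha : R) :
  (1 <= n)%N -> 0 < alpha < 1 -> 0 < kappa -> 0 < v ->
  mutually_independent X -> (forall i, ('E_P[X i] = 0)%E) ->
  (forall i (m : nat), (2 <= m)%N ->
       ('E_P[fun w => (`|X i w| ^+ m)%R]
         <= (v * m`!%:R * kappa ^+ (m - 2) / 2)%:E)%E) ->
  exists2 E : set T, measurable E & (P E <= alpha%:E)%E /\
    forall w, ~ E w -> forall j : nat, (j <= n)%N ->
      `|walk X j w| <= n%:R * tau n kappa v alpha.
Proof.
move=> n1 a01 k0 v0 indX mean mom.
have [] := tau_quadratic n1 a01 k0 v0; set x := _ * _ => x0 x2.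
have /andP[a0 _] := a01.
have n0 : 0 < n%:R :> R by rewrite ltr0n.
pose D := n%:R * v + kappa * x.
have D0 : 0 < D by rewrite addr_gt0// mulr_gt0.
(* The usual choice in Bernstein's inequality: 1 - lam kappa becomes n v / D, so n c = x^2 / (2 D)
   is half of lam x = x^2 / D. *)
pose lam := x / D.
have lam0 : 0 < lam by rewrite divr_gt0.
have lk : 1 - lam * kappa = n%:R * v / D.
  by rewrite /lam /D; field; rewrite gt_eqF.
pose c := lam ^+ 2 * v / 2 / (1 - lam * kappa).
have lk0 : 0 < 1 - lam * kappa by rewrite lk !divr_gt0// mulr_gt0.
have c0 : 0 <= c by rewrite divr_ge0 ?(ltW lk0)// divr_ge0// mulr_ge0 ?sqr_ge0// ltW.
have ncE : n%:R * c - lam * x = ln (alpha / 2).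
  have -> : n%:R * c - lam * x = - (x ^+ 2 / (2 * D)).
    rewrite /c lk /lam; field.
    by rewrite !gt_eqF.
  rewrite x2 -/D; field; by rewrite gt_eqF.
(* The bound [c] involves only s^2 and |s|, so it serves both signs, one for each side of the
   walk. *)
have tail s : `|s| = lam -> (P (~` walk_below X s (lam * x) n) <= (alpha / 2)%:E)%E.
  move=> sl.
  rewrite -[alpha / 2]lnK ?posrE ?divr_gt0// -ncE.
  apply: exp_maximal_inequality => //; first by rewrite mulr_ge0// ltW.
  move=> i.
  have -> : c = s ^+ 2 * v / 2 / (1 - `|s| * kappa).
    by rewrite /c -(real_normK (num_real s)) sl.
  apply: bernstein_mgf => //; [exact: ltW|exact: ltW| |exact: mom].
  by rewrite sl -subr_gt0.
have mX k (i : 'I_n) : (i < k)%N -> measurable_fun setT (X i) by [].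
have mwb s : measurable (~` walk_below X s (lam * x) n).
  by apply: measurableC; exact: (measurable_walk_below s (lam * x) (mX n)).
exists (~` walk_below X lam (lam * x) n `|` ~` walk_below X (- lam) (lam * x) n).
  exact: measurableU.
split.
  apply: (le_trans (measureU2 _ _ _)) => //.
  rewrite [alpha in leRHS](splitr alpha) EFinD; apply: leeD; apply: tail.
    by rewrite gtr0_norm.
  by rewrite normrN gtr0_norm.
move=> w; rewrite -setCI => /contrapT [up down] j jn.
rewrite ler_norml; apply/andP; split; rewrite -(ler_pM2l lam0); last exact: up.
by have := down j jn; rewrite mulNr mulrN lerNl.
Qed.

(** * Step functions and the Kolmogorov distance *)

Section completed_lebesgue_integral.
Context {R : realType}.
Implicit Types (f g h : R -> R) (a b c x : R).
Local Notation mu := (@completed_lebesgue_measure R).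
Local Notation leb A := (A%classic : set (lebesgueType R)).

Lemma measurable_lebesgueType (A : set R) : measurable A -> measurable (leb A).
Proof. exact: sub_caratheodory. Qed.

Lemma measurable_fun_lebesgueType (A : set R) g : measurable A ->
  measurable_fun A g -> measurable_fun (leb A) (g : lebesgueType R -> R).
Proof.
by move=> mA mg _ B mB; apply: measurable_lebesgueType; exact: mg.
Qed.

Lemma measurable_lebesgue_itv (i : interval R) : measurable (leb [set` i]).
Proof. exact: measurable_lebesgueType. Qed.

Lemma completed_lebesgue_itv a b (b0 b1 : bool) : a <= b ->
  mu [set` Interval (BSide b0 a) (BSide b1 b)] = (b - a)%:E.
Proof.
move=> ab; rewrite (_ : mu _ = lebesgue_measure [set` Interval (BSide b0 a) (BSide b1 b)])//.
rewrite lebesgue_measure_itv/= lte_fin; move: ab; rewrite le_eqVlt => /predU1P[->|ab].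
  by rewrite ltxx subrr.
by rewrite ab EFinB.
Qed.

Lemma completed_lebesgue_set1 a : mu [set a] = 0%E.
Proof. exact: lebesgue_measure_set1. Qed.


Lemma Linfty_integrable g : Linfty g -> mu.-integrable (leb `[0, 1]) (EFin \o g).
Proof.
move=> [mg [M aeM]].
apply/integrableP; split; first exact/measurable_EFinP.
apply: (@le_lt_trans _ _ (\int[mu]_(x in leb `[0%R, 1%R]) (`|M|)%:E)%E).
  apply: ae_ge0_le_integral.
  - exact: measurable_lebesgue_itv.
  - by move=> t _; exact: abse_ge0.
  - by apply: measurableT_comp; [exact: abse_measurable|exact/measurable_EFinP].
  - by move=> t _; rewrite lee_fin.
  - exact: measurable_cst.
  - case: aeM => N [mN N0 hN]; exists N; split => // t /= h; apply: hN => h'.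
    apply: h => /=; rewrite in_itv/= => t01; rewrite lee_fin.
    by rewrite (le_trans (h' t01))// ler_norm.
rewrite integral_cst//; last exact: measurable_lebesgue_itv.
by rewrite [X in (_ * X)%E]completed_lebesgue_itv// subr0 mule1 ltry.
Qed.

Lemma integrable_sub01 g a c : Linfty g -> 0 <= a -> c <= 1 ->
  mu.-integrable (leb `[a, c]) (EFin \o g).
Proof.
move=> /Linfty_integrable ig a0 c1; apply: integrableS ig.
- exact: measurable_lebesgue_itv.
- exact: measurable_lebesgue_itv.
- move=> t /=; rewrite !in_itv/= => /andP[at_ tc].
  by rewrite (le_trans a0 at_) (le_trans tc c1).
Qed.

(** Cells are open, so nothing is assumed at the end points, which form a null set. *)
Lemma Rintegral_itv_cst g a b c : a <= b ->
  measurable_fun (leb `[a, b]) (g : lebesgueType R -> R) ->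
  (forall t, a < t < b -> g t = c) ->
  \int[mu]_(t in `[a, b]) g t = c * (b - a).
Proof.
move=> ab mg gc.
transitivity (\int[mu]_(t in leb `[a, b]) c); last first.
  rewrite Rintegral_cst; last exact: measurable_lebesgue_itv.
  by rewrite [X in fine X]completed_lebesgue_itv.
congr fine; apply: ae_eq_integral.
- exact: measurable_lebesgue_itv.
- exact/measurable_EFinP.
- exact: measurable_cst.
exists (leb [set a] `|` leb [set b]); split.
- by apply: measurableU; apply: measurable_lebesgueType.
- apply/eqP; rewrite eq_le measure_ge0 andbT.
  apply: le_trans (measureU2 _ _ _) _.
  - exact: measurable_lebesgueType.
  - exact: measurable_lebesgueType.
  rewrite [X in (X + _)%E]completed_lebesgue_set1.
  by rewrite [X in (_ + X)%E]completed_lebesgue_set1 adde0.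
- move=> t /= h; apply: contrapT => /not_orP[ta tb]; apply: h.
  rewrite in_itv/= => /andP[at_ tb_]; rewrite gc//.
  by rewrite !lt_neqAle at_ tb_ !andbT; apply/andP; split; apply/eqP => e; [exact/ta|exact/tb].
Qed.

Lemma Rintegral_itv_add g a b c : a <= b -> b <= c ->
  mu.-integrable (leb `[a, c]) (EFin \o g) ->
  \int[mu]_(t in `[a, c]) g t =
  \int[mu]_(t in `[a, b]) g t + \int[mu]_(t in `[b, c]) g t.
Proof.
move=> ab bc ig.
have sub (i j : interval R) : {subset i <= j} -> leb [set` i] `<=` leb [set` j] by move=> ij t /ij.
have iS (i : interval R) : {subset i <= `[a, c]} -> mu.-integrable (leb [set` i]) (EFin \o g).
  move=> ij; apply: integrableS ig; last exact: sub.
    exact: measurable_lebesgue_itv.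
  exact: measurable_lebesgue_itv.
have E1 : \int[mu]_(t in leb `[b, c]) g t = \int[mu]_(t in leb `]b, c]) g t.
  rewrite -(@setU1itv _ _ (BRight c) b false) ?bnd_simp//.
  rewrite Rintegral_setU//.
  - rewrite [X in X + _](_ : _ = 0) ?add0r//.
    rewrite /Rintegral null_set_integral.
    + by [].
    + exact: measurable_lebesgueType.
    + exact: measurable_fun_set1.
    + exact: completed_lebesgue_set1.
  - exact: measurable_lebesgueType.
  - exact: measurable_lebesgue_itv.
  - rewrite setU1itv ?bnd_simp//; apply: iS => t; rewrite !in_itv/= => /andP[bt ->].
    by rewrite (le_trans ab).
  - apply/disj_setPS => t [/= ->]; by rewrite in_itv/= ltxx.
rewrite E1 -Rintegral_setU//.
- congr (Rintegral _ _ _); apply/seteqP; split => t /=; rewrite !in_itv/=.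
    move=> /andP[at_ tc]; case: (leP t b) => tb; [left|right]; apply/andP; split => //.
  move=> [/andP[at_ tb]|/andP[bt tc]]; apply/andP; split => //.
    exact: le_trans bc.
  exact/ltW/le_lt_trans/bt.
- exact: measurable_lebesgue_itv.
- exact: measurable_lebesgue_itv.
- apply: integrableS ig.
  + exact: measurable_lebesgue_itv.
  + by apply: measurableU; exact: measurable_lebesgue_itv.
  + move=> t /=; rewrite !in_itv/= => -[/andP[at_ tb]|/andP[bt tc]]; apply/andP; split => //.
      exact: le_trans bc.
    exact/ltW/(le_lt_trans ab).
- apply/disj_setPS => t [/=]; rewrite !in_itv/= => /andP[_ tb] /andP[bt _].
  by move: bt; rewrite ltNge tb.
Qed.
End completed_lebesgue_integral.

(** * Representatives of step functions in [calL] *)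

Section piecewise_constant.
Context {R : realType}.
Local Notation mu := (@completed_lebesgue_measure R).
Local Notation leb A := (A%classic : set (lebesgueType R)).
Variables (n : nat) (b : nat -> R).

(* Writing a step function as b 0 plus its jumps extends it constantly beyond the
   end points, so that the average of the one-sided limits is the right value at
   0 and 1, where local_avg only sees one side. *)
Definition jump_sum (s : nat -> bool) : R :=
  b 0%N + \sum_(1 <= i < n) (b i - b i.-1) * (s i)%:R.

(** The one-sided limits: a jump located at [t] counts for [<=] and not for [<]. *)
Definition right_value (t : R) : R := jump_sum (fun i => i%:R / n%:R <= t).
Definition left_value (t : R) : R := jump_sum (fun i => i%:R / n%:R < t).
Definition step_fun (t : R) : R := (left_value t + right_value t) / 2.

Lemma eq_jump_sum (s s' : nat -> bool) :
  (forall i, (1 <= i < n)%N -> s i = s' i) -> jump_sum s = jump_sum s'.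
Proof.
by move=> ss'; congr (_ + _); apply: eq_big_nat => i hi; rewrite ss'.
Qed.

Lemma jump_sum_initial (j : nat) : (j < n)%N -> jump_sum (fun i => (i <= j)%N) = b j.
Proof.
move=> jn; rewrite /jump_sum (@big_cat_nat _ _ _ j.+1)//=.
rewrite [X in _ + (_ + X)](_ : _ = 0) ?addr0; last first.
  by rewrite big_nat big1// => i /andP[ji _]; rewrite leqNgt ji mulr0.
rewrite big_add1/= (eq_big_nat _ _ (F2 := fun i => b i.+1 - b i)).
  by rewrite telescope_sumr// addrC subrK.
by move=> i /andP[_ ij]; rewrite ij mulr1.
Qed.

Lemma step_fun_cell (j : 'I_n) t : cell j t -> step_fun t = b j.
Proof.
rewrite /cell/= in_itv/= => /andP[jt tj].
have n0 : 0 < n%:R :> R by rewrite ltr0n (leq_ltn_trans _ (ltn_ord j)).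
(* [c] selects the comparison; as no grid point lies in the cell, both count exactly the jumps up to
   [j]. *)
have E (c : bool) i : (if c then i%:R / n%:R <= t else i%:R / n%:R < t) = (i <= j)%N.
  case: (leqP i j) => ij.
    have h : i%:R / n%:R < t.
      by apply: le_lt_trans jt; rewrite ler_pM2r ?invr_gt0// ler_nat.
    by case: c => //; exact: ltW.
  have h : t < i%:R / n%:R.
    by apply: (lt_le_trans tj); rewrite ler_pM2r ?invr_gt0// ler_nat.
  by case: c; apply/negbTE; rewrite -?leNgt -?ltNge// ltW.
rewrite /step_fun /left_value /right_value.
rewrite (eq_jump_sum (s' := fun i => (i <= j)%N)); last by move=> i _; exact: (E false).
rewrite (eq_jump_sum (s' := fun i => (i <= j)%N)); last by move=> i _; exact: (E true).
by rewrite jump_sum_initial//; field.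
Qed.

Lemma measurable_step_fun : measurable_fun setT step_fun.
Proof.
have mj (A : nat -> set R) : (forall i, measurable (A i)) ->
    measurable_fun setT (fun t => b 0%N + \sum_(1 <= i < n) (b i - b i.-1) * \1_(A i) t).
  move=> mA; apply: measurable_funD => //; apply: measurable_sum => i.
  by apply: measurable_funM => //; exact: measurable_indic.
apply: measurable_funM => //; apply: measurable_funD.
  have := mj (fun i => `]i%:R / n%:R, +oo[%classic) (fun i => measurable_itv _).
  congr measurable_fun; apply/funext => t; rewrite /left_value /jump_sum; congr (_ + _).
  apply: eq_bigr => i _; rewrite indicE; congr (_ * _%:R).
  by rewrite mem_setE in_itv/= andbT.
have := mj (fun i => `[i%:R / n%:R, +oo[%classic) (fun i => measurable_itv _).
congr measurable_fun; apply/funext => t; rewrite /right_value /jump_sum; congr (_ + _).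
apply: eq_bigr => i _; rewrite indicE; congr (_ * _%:R).
by rewrite mem_setE in_itv/= andbT.
Qed.

Lemma step_fun_bounded t : `|step_fun t| <= `|b 0%N| + \sum_(1 <= i < n) `|b i - b i.-1|.
Proof.
have H s : `|jump_sum s| <= `|b 0%N| + \sum_(1 <= i < n) `|b i - b i.-1|.
  apply: (le_trans (ler_normD _ _)); apply: lerD => //.
  apply: (le_trans (ler_norm_sum _ _ _)); apply: ler_sum => i _.
  by rewrite normrM; case: (s i); rewrite ?normr1 ?mulr1 ?normr0 ?mulr0.
rewrite /step_fun normrM [`|2^-1|]gtr0_norm ?invr_gt0// ler_pdivrMr//.
apply: (le_trans (ler_normD _ _)).
by rewrite mulr_natr mulr2n; apply: lerD; exact: H.
Qed.

Lemma Linfty_step_fun : Linfty step_fun.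
Proof.
split.
  apply: measurable_fun_lebesgueType => //.
  by apply: measurable_funTS; exact: measurable_step_fun.
exists (`|b 0%N| + \sum_(1 <= i < n) `|b i - b i.-1|).
by apply: aeW => t _; exact: step_fun_bounded.
Qed.

Lemma integral_two_values g t u w l r : Linfty g -> 0 <= u -> w <= 1 ->
  u <= t -> t <= w ->
  (forall s, u < s < t -> g s = l) -> (forall s, t < s < w -> g s = r) ->
  \int[mu]_(s in `[u, w]) g s = l * (t - u) + r * (w - t).
Proof.
move=> Lg u0 w1 ut tw gl gr.
rewrite (Rintegral_itv_add ut tw) ?integrable_sub01//.
congr (_ + _); apply: Rintegral_itv_cst => //.
  apply/measurable_EFinP; apply: (measurable_int mu).
  by apply: integrable_sub01 => //; exact: le_trans w1.
apply/measurable_EFinP; apply: (measurable_int mu).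
by apply: integrable_sub01 => //; exact: le_trans ut.
Qed.

Hypothesis n_gt0 : (0 < n)%N.

(** For [e] this small the window meets no grid point other than [t] and is clipped only at an end
    point equal to [t]; the function is constant on each side, so the average is exact before any
    limit. *)
Lemma local_avg_step_fun t e d : 0 <= t <= 1 -> 0 < d < e -> e < 1 ->
  (0 < t -> e < t) -> (t < 1 -> e < 1 - t) ->
  (forall i : 'I_n, i%:R / n%:R != t -> e < `|i%:R / n%:R - t|) ->
  local_avg step_fun t d = step_fun t.
Proof.
move=> /andP[t0 t1] /andP[d0 de] e1 et et1 sep.
have n0 : 0 < n%:R :> R by rewrite ltr0n.
have sepi i : (i < n)%N -> [\/ i%:R / n%:R = t, t + e < i%:R / n%:R | i%:R / n%:R < t - e].
  move=> ilt; have [->|/(sep (Ordinal ilt))] := eqVneq (i%:R / n%:R) t; first by constructor 1.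
  rewrite /= ltr_normr => /orP[h|h]; [constructor 2|constructor 3]; lra.
have Hr s : t < s < t + e -> step_fun s = right_value t.
  move=> /andP[ts se].
  have E (c : bool) i : (1 <= i < n)%N ->
      (if c then i%:R / n%:R <= s else i%:R / n%:R < s) = (i%:R / n%:R <= t).
    move=> /andP[_ ilt]; case: (sepi _ ilt) => [->|h|h].
    - by rewrite lexx ts (ltW ts); case: c.
    - rewrite [RHS]leNgt (lt_trans _ h) ?ltrDl ?(lt_trans d0)//=.
      case: c; apply/negbTE; rewrite -?leNgt -?ltNge.
        exact: lt_trans h.
      exact/ltW/(lt_trans se).
    - have h' : i%:R / n%:R <= t by apply/ltW/(lt_trans h); rewrite gtrBl (lt_trans d0).
      by rewrite h' (le_lt_trans h' ts) (le_trans h' (ltW ts)); case: c.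
  rewrite /step_fun /left_value {1}/right_value.
  rewrite (eq_jump_sum (fun i hi => E false i hi)) (eq_jump_sum (fun i hi => E true i hi)).
  by rewrite -/(right_value t); field.
have Hl s : t - e < s < t -> step_fun s = left_value t.
  move=> /andP[es st].
  have E (c : bool) i : (1 <= i < n)%N ->
      (if c then i%:R / n%:R <= s else i%:R / n%:R < s) = (i%:R / n%:R < t).
    move=> /andP[_ ilt]; case: (sepi _ ilt) => [->|h|h].
    - by rewrite ltxx leNgt st ltNge (ltW st); case: c.
    - have h' : t < i%:R / n%:R by apply: lt_trans h; rewrite ltrDl (lt_trans d0).
      rewrite [RHS]ltNge (ltW h')/=.
      case: c; apply/negbTE; rewrite -?leNgt -?ltNge.
        exact: lt_trans h'.
      exact/ltW/(lt_trans st).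
    - have h' : i%:R / n%:R < s by exact: lt_trans es.
      by rewrite (lt_trans h' st) h' (ltW h'); case: c.
  rewrite /step_fun {1}/left_value /right_value.
  rewrite (eq_jump_sum (fun i hi => E false i hi)) (eq_jump_sum (fun i hi => E true i hi)).
  by rewrite -/(left_value t); field.
have tm : Num.max 0 (t - d) <= t by rewrite ge_max t0 gerBl ltW.
have tp : t <= Num.min 1 (t + d) by rewrite le_min t1 lerDl ltW.
rewrite /local_avg /tminus /tplus.
rewrite (@integral_two_values _ t _ _ (left_value t) (right_value t))//.
- have n1 i : (1 <= i)%N -> 0 < i%:R / n%:R :> R by move=> i1; rewrite divr_gt0// ltr0n.
  (* At 0 and 1 only one half of the window survives, but all jumps are interior, so the two
     one-sided values coincide there. *)
  have [t0'|t0'|t0'] := ltgtP 0 t; last 2 first.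
  + by move: t0; rewrite leNgt t0'.
  + have eLR : left_value t = right_value t.
      apply: eq_jump_sum => i /andP[i1 _]; rewrite -t0'.
      by rewrite [RHS]leNgt n1// ltNge (ltW (n1 _ i1)).
    rewrite /step_fun eLR -t0' sub0r add0r max_l ?oppr_le0 ?(ltW d0)//.
    rewrite min_r ?(ltW (lt_trans de e1))// subrr mulr0 add0r subr0.
    by field; rewrite gt_eqF.
  have [t1'|t1'|t1'] := ltgtP t 1.
  + have := et t0'; have := et1 t1' => h1 h2.
    rewrite max_r; last lra.
    rewrite min_r; last lra.
    by rewrite /step_fun; field; rewrite ?gt_eqF//; lra.
  + by move: t1; rewrite leNgt t1'.
  + have h2 := et t0'.
    have eLR : right_value t = left_value t.
      apply: eq_jump_sum => i /andP[_ ilt]; rewrite t1'.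
      have h : i%:R / n%:R < 1 :> R by rewrite ltr_pdivrMr// mul1r ltr_nat.
      by rewrite h (ltW h).
    rewrite /step_fun eLR max_r; last lra.
    rewrite t1' min_l; last lra.
    rewrite subrr mulr0 addr0; field; lra.
- exact: Linfty_step_fun.
- by rewrite le_max lexx.
- by rewrite ge_min lexx.
- move=> s /andP[]; rewrite gt_max => /andP[_ ds] st; apply: Hl; rewrite st andbT.
  by apply: le_lt_trans ds; rewrite lerD2l lerN2 ltW.
- move=> s /andP[ts]; rewrite lt_min => /andP[_ ds]; apply: Hr; rewrite ts/=.
  by apply: (lt_trans ds); rewrite ltrD2l.
Qed.

Lemma calL_step_fun : calL step_fun.
Proof.
split; first exact: Linfty_step_fun.
move=> t t01; apply: cvg_near_cst.
have pos r : \forall e \near (0:R)^'+, 0 < r -> e < r.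
  by have [r0|_] := ltP 0 r; [near=> e => _; near: e; exact: nbhs_right_lt|near=> e].
have sep : \forall e \near (0:R)^'+, forall i : 'I_n, i%:R / n%:R != t -> e < `|i%:R / n%:R - t|.
  apply: filter_forall => i; apply: filterS (pos `|i%:R / n%:R - t|) => e h it.
  by apply: h; rewrite normr_gt0 subr_eq0.
near=> e.
(* The set of averages is a singleton; the radius [e / 2] below shows that it is not empty, where
   the infimum would be +oo. *)
rewrite (_ : [set _ | d in _] = [set (step_fun t)%:E]) ?ereal_inf1//.
have e0 : 0 < e by near: e; exact: nbhs_right_gt.
have key d : 0 < d < e -> local_avg step_fun t d = step_fun t.
  move=> de; apply: (@local_avg_step_fun t e d) => //.
  - by near: e; exact: pos.
  - by rewrite -subr_gt0; near: e; exact: pos.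
  - by near: e.
apply/seteqP; split => [_ [d /= + <-]|_ ->].
  by rewrite in_itv/= => de; rewrite key.
exists (e / 2) => /=; last rewrite key//.
  by rewrite in_itv/= divr_gt0//= ltr_pdivrMr// ltr_pMr// ltr1n.
by rewrite divr_gt0//= ltr_pdivrMr// ltr_pMr// ltr1n.
Unshelve. all: by end_near.
Qed.

End piecewise_constant.

(** The witness for [get] is [step_fun]; the values of [b] from [n] on are arbitrary, as [jump_sum]
    reads only smaller indices. *)
Lemma pcfunP (R : realType) (n : nat) (a : 'I_n -> R) : (0 < n)%N ->
  PC n (pcfun a) /\ forall (i : 'I_n) t, cell i t -> pcfun a t = a i.
Proof.
move=> n0.
pose b i := if insub i is Some j then a j else 0.
have bE (i : 'I_n) : b i = a i by rewrite /b valK.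
have C (i : 'I_n) t : cell i t -> step_fun n b t = a i.
  by move=> /step_fun_cell ->; rewrite bE.
apply: (@getPex _ [set g | PC n g /\ forall (i : 'I_n) t, cell i t -> g t = a i]).
exists (step_fun n b); split => //; split; first exact: calL_step_fun.
by move=> i; exists (a i) => t; exact: C.
Qed.

(** * Kolmogorov distance and approximation by few modes *)

Section kolmogorov_distance.
Context {R : realType}.
Implicit Types (f g h : R -> R).
Local Notation mu := (@completed_lebesgue_measure R).

Lemma LinftyB f g : Linfty f -> Linfty g -> Linfty (fun t => f t - g t).
Proof.
move=> [mf [M aM]] [mg [M' aM']]; split; first exact: measurable_funB.
exists (M + M'); have F : Filter (almost_everywhere mu) by exact: ae_filter_ringOfSetsType.
apply: (@filterS2 _ _ F _ _ _ _ aM aM') => t hf hg t01.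
by apply: (le_trans (ler_normB _ _)); apply: lerD; [exact: hf|exact: hg].
Qed.

Lemma dK_triangle f g h : Linfty f -> Linfty g -> Linfty h ->
  (dK f h <= dK f g + dK g h)%E.
Proof.
move=> Lf Lg Lh; apply: ge_ereal_sup => _ [x /= x01 <-].
have /andP[x0 x1] : 0 <= x <= 1 by move: x01; rewrite in_itv.
have -> : \int[mu]_(s in `[0, x]) (f s - h s) =
    \int[mu]_(s in `[0, x]) (f s - g s) + \int[mu]_(s in `[0, x]) (g s - h s).
  rewrite -RintegralD//.
  - by apply: eq_Rintegral => s _; ring.
  - exact: measurable_lebesgue_itv.
  - exact: (integrable_sub01 (LinftyB Lf Lg)).
  - exact: (integrable_sub01 (LinftyB Lg Lh)).
apply: (@le_trans _ _ (`|\int[mu]_(s in `[0, x]) (f s - g s)|%:E +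
    `|\int[mu]_(s in `[0, x]) (g s - h s)|%:E)%E).
  by rewrite -EFinD lee_fin ler_normD.
by apply: leeD; apply: ereal_sup_ubound; exists x.
Qed.

Lemma dK_ge0 f g : (0 <= dK f g)%E.
Proof.
apply: (@le_trans _ _ (`|\int[mu]_(s in `[0, 0]) (f s - g s)|%:E)%E).
  by rewrite lee_fin.
by apply: ereal_sup_ubound; exists 0 => //=; rewrite in_itv/= lexx ler01.
Qed.

Lemma dK_refl f : dK f f = 0%E.
Proof.
apply/eqP; rewrite eq_le dK_ge0 andbT; apply: ge_ereal_sup => _ [x _ <-].
rewrite lee_fin; under eq_Rintegral do rewrite subrr.
by rewrite /Rintegral integral0 normr0.
Qed.

Lemma Rintegral_grid (n : nat) (G : R -> R) (D : 'I_n -> R) (m : nat) :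
  (0 < n)%N -> Linfty G -> (forall i t, cell i t -> G t = D i) -> (m <= n)%N ->
  \int[mu]_(s in `[0, m%:R / n%:R]) G s = (\sum_(i < n | (i < m)%N) D i) / n%:R.
Proof.
move=> n_gt0 LG GD.
have n0 : 0 < n%:R :> R by rewrite ltr0n.
elim: m => [_|m IH mn].
  rewrite (@Rintegral_itv_cst _ G _ _ 0) ?mul0r//.
  - by rewrite big_pred0_eq mul0r.
  - by apply/measurable_EFinP; apply: (measurable_int mu); exact: integrable_sub01.
  - by move=> t /andP[t0 t0']; have := lt_trans t0 t0'; rewrite ltxx.
have le1 : m.+1%:R / n%:R <= 1 :> R by rewrite ler_pdivrMr// mul1r ler_nat.
have mS : m%:R / n%:R <= m.+1%:R / n%:R :> R by rewrite ler_pM2r ?invr_gt0// ler_nat.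
have m0 : 0 <= m%:R / n%:R :> R by rewrite divr_ge0.
rewrite (Rintegral_itv_add m0 mS) ?integrable_sub01// (IH (ltnW mn)).
rewrite (@Rintegral_itv_cst _ G _ _ (D (Ordinal mn)))//.
- rewrite [in RHS](bigD1 (Ordinal mn))//= [in RHS]addrC mulrDl; congr (_ / _ + _).
    apply: eq_bigl => i; rewrite ltnS ltn_neqAle andbC; congr andb.
  by rewrite -natr1; field; rewrite gt_eqF.
- by apply/measurable_EFinP; apply: (measurable_int mu); exact: integrable_sub01.
- by move=> t mt; apply: GD; rewrite /cell/= in_itv.
Qed.

Lemma dK_le_grid (n : nat) f g (D : 'I_n -> R) (B : R) :
  (0 < n)%N -> Linfty f -> Linfty g -> (forall i t, cell i t -> f t - g t = D i) ->
  (forall m : nat, (m <= n)%N -> `|\sum_(i < n | (i < m)%N) D i| <= n%:R * B) ->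
  (dK f g <= B%:E)%E.
Proof.
move=> n_gt0 Lf Lg fgD DB.
have n0 : 0 < n%:R :> R by rewrite ltr0n.
have LG := LinftyB Lf Lg.
apply: ge_ereal_sup => _ [x /= x01 <-]; rewrite lee_fin.
have /andP[x0 x1] : 0 <= x <= 1 by move: x01; rewrite in_itv.
(* At x = 1 the integer part of n x is n, which is not the index of a cell. *)
have [x1'|x1'] := eqVneq x 1.
  have -> : x = n%:R / n%:R by rewrite divff ?gt_eqF.
  rewrite (Rintegral_grid n_gt0 LG fgD)// normrM (gtr0_norm (x := n%:R^-1)) ?invr_gt0//.
  by rewrite ler_pdivrMr// mulrC DB.
pose m := Num.truncn (n%:R * x).
have /andP[m1 m2] : m%:R <= n%:R * x < m.+1%:R by apply: truncn_itv; rewrite mulr_ge0// ltW.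
have mn : (m < n)%N.
  rewrite -(ltr_nat R); apply: (le_lt_trans m1).
  by rewrite gtr_pMr// lt_neqAle x1' x1.
have mx : m%:R / n%:R <= x by rewrite ler_pdivrMr// mulrC.
have m0 : 0 <= m%:R / n%:R :> R by rewrite divr_ge0.
rewrite (@Rintegral_itv_add _ _ 0 (m%:R / n%:R) x) ?integrable_sub01//.
rewrite (Rintegral_grid n_gt0 LG fgD (ltnW mn)).
rewrite (@Rintegral_itv_cst _ _ _ _ (D (Ordinal mn)) mx); last 2 first.
- apply/measurable_EFinP; apply: (measurable_int mu); exact: integrable_sub01.
- move=> t /andP[t1 t2]; apply: fgD; rewrite /cell/= in_itv/= t1 (lt_trans t2)//.
  by rewrite ltr_pdivlMr// mulrC.
set S := \sum_(i < n | (i < m)%N) D i.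
have SS : \sum_(i < n | (i < m.+1)%N) D i = S + D (Ordinal mn).
  rewrite (bigD1 (Ordinal mn))//= addrC; congr (_ + _).
  apply: eq_bigl => i; rewrite ltnS ltn_neqAle andbC; congr andb.
(* The relative position of [x] in its cell, hence the weight in a convex combination of two
   consecutive partial sums. *)
pose th := n%:R * x - m%:R.
have -> : S / n%:R + D (Ordinal mn) * (x - m%:R / n%:R) =
    ((1 - th) * S + th * (S + D (Ordinal mn))) / n%:R.
  by rewrite /th; field; rewrite gt_eqF.
rewrite normrM (gtr0_norm (x := n%:R^-1)) ?invr_gt0// ler_pdivrMr//.
apply: (le_trans (ler_normD _ _)).
have th0 : 0 <= th by rewrite subr_ge0.
have th1 : 0 <= 1 - th by rewrite /th; rewrite -natr1 in m2; lra.
rewrite !normrM (ger0_norm th0) (ger0_norm th1).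
have := DB m (ltnW mn); have := DB m.+1 mn; rewrite SS -/S => h1 h2.
have := ler_wpM2l th0 h1; have := ler_wpM2l th1 h2; lra.
Qed.

Lemma s_le_add n j f g (B : R) : Linfty f -> Linfty g -> (dK f g <= B%:E)%E ->
  (s_ n j f <= B%:E + s_ n j g)%E.
Proof.
move=> Lf Lg fgB; rewrite -leeBlDl//; apply: le_ereal_inf_tmp => _ [h Xh <-].
rewrite leeBlDl//; apply: (@le_trans _ _ (dK f h)).
  by apply: ereal_inf_lbound; exists h.
apply: (le_trans (dK_triangle Lf Lg _)); first by case: Xh => -[[]].
exact: leeD2r.
Qed.

Lemma s_decreasing n g i j : (i <= j)%N -> (s_ n j g <= s_ n i g)%E.
Proof.
move=> ij; apply: ereal_inf_le_tmp => _ [h [PCh Mh] <-]; exists h => //; split => //.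
by apply: (le_trans Mh); rewrite lee_fin ler_nat.
Qed.

End kolmogorov_distance.

(** * Modes and measurability *)

Section number_of_modes.
Context {R : realType}.
Implicit Types (g : R -> R) (t : R).

(* Distinct points of equal rank lie in a common cell, so the rank increases from
   each mode of a partition to the next point. *)
Definition grid_rank (n : nat) t : nat :=
  (Num.truncn (n%:R * t) + (n - Num.truncn (n%:R * (1 - t))))%N.

Lemma grid_rank_le n t t' : t <= t' -> (grid_rank n t <= grid_rank n t')%N.
Proof.
move=> tt'; apply: leq_add; first by apply: le_truncn; exact: ler_wpM2l.
by apply: leq_sub2l; apply: le_truncn; apply: ler_wpM2l => //; rewrite lerB.
Qed.

Lemma grid_rank_bound n t : 0 <= t <= 1 -> (grid_rank n t <= n + n)%N.
Proof.
move=> /andP[t0 t1]; apply: leq_add; last exact: leq_subr.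
have /andP[+ _] : (Num.truncn (n%:R * t))%:R <= n%:R * t < (Num.truncn (n%:R * t)).+1%:R.
  by apply: truncn_itv; rewrite mulr_ge0.
move=> h; rewrite -(ler_nat R); apply: (le_trans h).
by rewrite -[leRHS]mulr1 ler_wpM2l.
Qed.

(** Both summands of the rank are nondecreasing, so both are equal at the two points. The first
    alone would not separate a grid point from the cell to its right; the second does. *)
Lemma grid_rank_eq_cell n t t' : (0 < n)%N -> 0 <= t -> t < t' -> t' <= 1 ->
  grid_rank n t = grid_rank n t' -> exists i : 'I_n, cell i t /\ cell i t'.
Proof.
move=> n_gt0 t0 tt' t1 e.
have ar (m m' w w' : nat) : (m <= m' -> w' <= w -> w <= n ->
    m + (n - w) = m' + (n - w') -> m = m' /\ w = w')%N by clear; lia.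
have n0 : 0 < n%:R :> R by rewrite ltr0n.
have ntt' : n%:R * t < n%:R * t' by rewrite ltr_pM2l.
have nt1 : n%:R * t' <= n%:R by rewrite -[leRHS]mulr1 ler_wpM2l.
pose m := Num.truncn (n%:R * t); pose m' := Num.truncn (n%:R * t').
pose w := Num.truncn (n%:R * (1 - t)); pose w' := Num.truncn (n%:R * (1 - t')).
have mm' : (m <= m')%N by exact/le_truncn/ltW.
have ww' : (w' <= w)%N by apply: le_truncn; apply: ler_wpM2l => //; rewrite lerB// ltW.
have /andP[m1 m2] : m%:R <= n%:R * t < m.+1%:R by apply: truncn_itv; rewrite mulr_ge0.
have /andP[m'1 m'2] : m'%:R <= n%:R * t' < m'.+1%:R.
  by apply: truncn_itv; rewrite mulr_ge0// (le_trans t0)// ltW.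
have t1' : t <= 1 by rewrite (le_trans _ t1)// ltW.
have /andP[w1 w2] : w%:R <= n%:R * (1 - t) < w.+1%:R.
  by apply: truncn_itv; rewrite mulr_ge0// subr_ge0.
have /andP[w'1 w'2] : w'%:R <= n%:R * (1 - t') < w'.+1%:R.
  by apply: truncn_itv; rewrite mulr_ge0// subr_ge0.
have wn : (w <= n)%N.
  rewrite -(ler_nat R); apply: (le_trans w1).
  by rewrite -[leRHS]mulr1 ler_wpM2l// gerBl.
have [em ew] := ar m m' w w' mm' ww' wn e.
(* If n t = m, then w' = w = n - m, whereas w' <= n (1 - t') < n - m. *)
have mt : m%:R < n%:R * t.
  rewrite lt_neqAle m1 andbT; apply/eqP => emt.
  have mn : (m <= n)%N.
    by rewrite -(ler_nat R) emt; apply: le_trans nt1; exact: ltW.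
  have : w = (n - m)%N.
    by rewrite /w mulrBr mulr1 -emt -natrB// natrK.
  move=> wE; move: w'1; rewrite -ew wE natrB// emt; lra.
have mn : (m < n)%N by rewrite -(ltr_nat R); apply: lt_le_trans nt1; exact: lt_trans ntt'.
exists (Ordinal mn); rewrite /cell/= !in_itv/= !ltr_pdivrMr// !ltr_pdivlMr//.
rewrite ![_ * n%:R]mulrC mt m2 (lt_trans mt ntt')/= em; split => //.
Qed.

(** Only finiteness matters: it makes [g] its own approximant in [X_ n (n + n)]. *)
Lemma modes_PC (n : nat) g : (0 < n)%N -> PC n g -> (modes g <= (n + n)%:R%:E)%E.
Proof.
move=> n_gt0 [_ gc]; apply: ge_ereal_sup => _ [s /= ip <-]; have [ps _] := ip.
rewrite lee_fin ler_nat /modes_on.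
set t := 0 :: s.
have tS k : (k < size s)%N -> nth 0 t k < nth 0 t k.+1.
  by move=> ks; have /(pathP 0) := ps; apply.
have t01 k : (k <= size s)%N -> 0 <= nth 0 t k <= 1.
  move=> ks; rewrite (@set_nth_default R t 1 0 k)//.
  by rewrite (itv_partition_nth_ge _ ip)//= (itv_partition_nth_le _ ip).
(* A strict drop to the right excludes a common cell, so every mode is paid for by one unit of
   rank. *)
have step k : (k < size s)%N ->
    ((Num.max (g (nth 0 t k.-1)) (g (nth 0 t k.+1)) < g (nth 0 t k))%R
      + grid_rank n (nth 0%R t k) <= grid_rank n (nth 0%R t k.+1))%N.
  move=> ks; have le := grid_rank_le n (ltW (tS k ks)).
  case E : (_ < _)%R; last by [].
  move: E; rewrite gt_max => /andP[_ gk]; rewrite add1n ltn_neqAle le andbT.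
  apply/eqP => /grid_rank_eq_cell.
  have /andP[tk0 _] := t01 k (ltnW ks); have /andP[_ tk1] := t01 k.+1 ks.
  move=> /(_ n_gt0 tk0 (tS k ks) tk1) [i [c1 c2]].
  have [c gcE] := gc i.
  by move: gk; rewrite (gcE _ c1) (gcE _ c2) ltxx.
have sum k : (k <= size s)%N ->
    ((\sum_(1 <= i < k) (Num.max (g (nth 0 t i.-1)) (g (nth 0 t i.+1)) < g (nth 0 t i))%R)
     <= grid_rank n (nth 0%R t k))%N.
  elim: k => [_|k IH ks]; first by rewrite big_geq.
  have [->|k0] := posnP k; first by rewrite big_geq.
  rewrite big_nat_recr//= addnC; apply: leq_trans (step k ks).
  by rewrite leq_add2l IH// ltnW.
apply: (leq_trans (sum _ (leqnn _))); apply: grid_rank_bound; exact: t01.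
Qed.

End number_of_modes.

(** The indices form an initial segment, nonempty since s_{-1} is infinite and bounded since s_{2n}
    vanishes; so [get] returns a true maximum. *)
Lemma k_leP (R : realType) (n : nat) (e : R) (g : R -> R) (K : nat) :
  (0 < n)%N -> PC n g -> 0 < e ->
  (K <= k_ n e g)%N <-> (e%:E <= s_pred n K g)%E.
Proof.
move=> n_gt0 PCg e0.
pose A := [set j : nat | (e%:E <= s_pred n j g)%E].
have A_down i j : (i <= j)%N -> A j -> A i.
  case: i => [_ _|i]; first by rewrite /A /= leey.
  case: j => // j ij; rewrite /A /= => h; apply: (le_trans h).
  exact: s_decreasing.
have A_bound j : A j -> (j <= n + n)%N.
  (* A larger index would put [(n + n).+1] in [A], and [s_pred] at that index is [s_ n (n + n) g],
     which is at most [dK g g]. *)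
  move=> Aj; rewrite leqNgt; apply/negP => /A_down /(_ Aj); rewrite /A /=.
  apply/negP; rewrite -ltNge (@le_lt_trans _ _ 0%E)//.
  apply: ge_ereal_inf; exists (dK g g); last by rewrite dK_refl.
  exists g => //; split => //; exact: modes_PC.
have [Ak kmax] : (A `&` [set j | forall i, A i -> (i <= j)%N]) (k_ n e g).
  apply: (@getPex _ (A `&` [set j | forall i, A i -> (i <= j)%N])).
  have exA : exists j, `[< A j >] by exists 0%N; apply/asboolP; rewrite /A /= leey.
  have ubA j : `[< A j >] -> (j <= n + n)%N by move=> /asboolP; exact: A_bound.
  case: (ex_maxnP exA ubA) => m /asboolP Am mmax; exists m; split => // i Ai.
  by apply: mmax; apply/asboolP.
by split => [/A_down|]; [exact|exact: kmax].
Qed.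

(* The sublevel set is the union, over rational points q, of the sublevel sets of
   the upper bounds |X - q| + F q of F X. *)
Lemma measurable_lipschitz_sublevel (d : measure_display)
    (T : measurableType d) (R : realType) (n : nat) (X : 'I_n -> T -> R)
    (F : ('I_n -> R) -> \bar R) (c : R) :
  (forall i, measurable_fun setT (X i)) ->
  (forall a b, (F a <= (\sum_i `|a i - b i|)%:E + F b)%E) ->
  measurable [set w | (F (fun i => X i w) < c%:E)%E].
Proof.
move=> mX Flip.
pose U (q : {ffun 'I_n -> rat}) :=
  [set w | ((\sum_i `|X i w - ratr (q i)|)%:E + F (fun i => ratr (q i)) < c%:E)%E].
have mU q : measurable (U q).
  have mS : measurable_fun setT (fun w => (\sum_i `|X i w - ratr (q i)|)%:E +
      F (fun i => ratr (q i)))%E.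
    apply: emeasurable_funD => //; apply/measurable_EFinP; apply: measurable_sum => i.
    by apply: measurableT_comp => //; exact: measurable_funB.
  have := measurable_preT mS (emeasurable_itv `]-oo, c%:E[).
  by congr measurable; apply/seteqP; split => w /=; rewrite in_itv.
rewrite (_ : mkset _ = \bigcup_q U q).
  by apply: countable_bigcupT_measurable => //; exact: countableP.
apply/seteqP; split => w /=; last first.
  by move=> [q _]; rewrite /U /=; apply: le_lt_trans.
move=> Fc.
suff [q Uq] : exists q, U q w by exists q.
have approx r : 0 < r -> exists q : {ffun 'I_n -> rat},
    \sum_i `|X i w - ratr (q i)| <= n%:R * r.
  move=> r0.
  have /choice[q hq] (i : 'I_n) : exists p : rat, `|X i w - ratr p| <= r.
    have [p] : exists p : rat, ratr p \in `](X i w - r), (X i w + r)[.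
      by apply: rat_in_itvoo; lra.
    by rewrite in_itv/= => /andP[p1 p2]; exists p; rewrite ler_norml; apply/andP; split; lra.
  exists [ffun i => q i].
  rewrite (@le_trans _ _ (\sum_(i < n) r))//; last by rewrite sumr_const card_ord mulr_natl.
  by apply: ler_sum => i _; rewrite ffunE.
have Fq q : (F (fun i => ratr (q i)) <= (\sum_i `|X i w - ratr (q i)|)%:E + F (fun i => X i w))%E.
  by have := Flip (fun i => ratr (q i)) (fun i => X i w); under eq_bigr do rewrite distrC.
case E : (F (fun i => X i w)) Fc => [y||]// yc.
  move: yc; rewrite lte_fin => yc.
  (* The error, at most n times this radius, is paid twice: from the point to [q] and back. The
     added 1 keeps the inequality strict and covers n = 0. *)
  have [|q hq] := approx ((c - y) / (2 * n%:R + 1)).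
    by rewrite divr_gt0 ?subr_gt0// ltr_wpDl// mulr_ge0.
  exists q; rewrite /U /=; apply: (le_lt_trans (leeD2l _ (Fq q))).
  rewrite E -!EFinD lte_fin.
  have : 2 * (n%:R * ((c - y) / (2 * n%:R + 1))) < c - y.
    rewrite !mulrA ltr_pdivrMr ?ltr_wpDl ?mulr_ge0//.
    by rewrite mulrC ltr_pM2l ?subr_gt0// ltrDl.
  move: hq; set S := \sum_i _; set z := n%:R * _; lra.
(* Here the value is -oo, and any rational point will do. *)
have [q _] := approx 1 ltr01.
exists q; rewrite /U /=; apply: (le_lt_trans (leeD2l _ (Fq q))).
by rewrite E !addeNy ltNyr.
Qed.

(** A crude estimate, without the factor 1/n, that suffices for measurability. *)
Lemma s_pcfun_lipschitz (R : realType) (n j : nat) (a b : 'I_n -> R) : (0 < n)%N ->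
  (s_ n j (pcfun a) <= (\sum_i `|a i - b i|)%:E + s_ n j (pcfun b))%E.
Proof.
move=> n_gt0.
have [[[La _] _] Ea] := pcfunP a n_gt0; have [[[Lb _] _] Eb] := pcfunP b n_gt0.
apply: s_le_add => //; apply: (@dK_le_grid _ n _ _ (fun i => a i - b i)) => //.
  by move=> i t it; rewrite (Ea i) ?(Eb i).
move=> m _; apply: (le_trans (ler_norm_sum _ _ _)).
rewrite (@le_trans _ _ (\sum_i `|a i - b i|))//.
  by rewrite [leRHS](bigID (fun i : 'I_n => (i < m)%N))/= lerDl sumr_ge0.
by rewrite ler_peMl ?sumr_ge0// ler1n.
Qed.

Theorem theorem4 (R : realType)
    (d : measure_display) (T : measurableType d) (P : probability T R)
    (X : set (R -> R)) (f : R -> R) (n : nat) (alpha : R)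
    (eps : 'I_n -> {RV P >-> R}) (kappa v : R) (k : nat)
    (hX : X `<=` calL) (hf : X f) (hn : (1 <= n)%N)
    (halpha : 0 < alpha < 1)
    (hindep : mutually_independent eps)
    (hmean : forall i : 'I_n, ('E_P[eps i] = 0)%E)
    (hkappa : 0 < kappa) (hv : 0 < v)
    (hmoment : forall (i : 'I_n) (m : nat), (2 <= m)%N ->
       ('E_P[fun w => (`|eps i w| ^+ m)%R]
         <= (v * m`!%:R * kappa ^+ (m - 2) / 2)%:E)%E)
    (hk : X_ n k (pcfun (fun i : 'I_n => f (i%:R / n%:R)))) :
  let fn : R -> R := pcfun (fun i : 'I_n => f (i%:R / n%:R)) in
  let Yn (w : T) : R -> R :=
    pcfun (fun i : 'I_n => f (i%:R / n%:R) + eps i w) in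
  (P [set w | (k_ n (tau n kappa v alpha) (Yn w)
               < k_ n (2 * tau n kappa v alpha) fn)%N] <= alpha%:E)%E.
Proof.
pose fn : R -> R := pcfun (fun i : 'I_n => f (i%:R / n%:R)).
pose Yn w : R -> R := pcfun (fun i : 'I_n => f (i%:R / n%:R) + eps i w).
change (is_true (P [set w | (k_ n (tau n kappa v alpha) (Yn w)
                   < k_ n (2 * tau n kappa v alpha) fn)%N] <= alpha%:E)%E).
have n0 : 0 < n%:R :> R by rewrite ltr0n.
set tau_ := tau n kappa v alpha.
have t0 : 0 < tau_.
  by have [] := tau_quadratic hn halpha hkappa hv; rewrite -/tau_ pmulr_rgt0.
have [E mE [PE hE]] := bernstein_maximal hn halpha hkappa hv hindep hmean hmoment.
have [PCfn fnE] := pcfunP (fun i : 'I_n => f (i%:R / n%:R)) hn.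
have PCY w := pcfunP (fun i : 'I_n => f (i%:R / n%:R) + eps i w) hn.
have t20 : 0 < 2 * tau_ by rewrite mulr_gt0.
have := (k_leP (k_ n (2 * tau_) fn) hn PCfn t20).1 (leqnn _).
case: (k_ n (2 * tau_) fn) => [_|j /= sfn].
  rewrite (_ : mkset _ = set0); last by apply/seteqP; split.
  by rewrite measure0 lee_fin ltW//; case/andP: halpha.
(* This form of the event shows its measurability, without which P is junk. *)
rewrite (_ : mkset _ = [set w | (s_ n j (Yn w) < tau_%:E)%E]); last first.
  apply/seteqP; split => w /= h.
    rewrite ltNge; apply/negP => /(k_leP j.+1 hn (PCY w).1 t0).
    by rewrite leqNgt h.
  rewrite ltnNge; apply/negP => /(k_leP j.+1 hn (PCY w).1 t0) /=.
  by rewrite leNgt h.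
apply: le_trans PE; apply: le_measure; rewrite ?inE//.
  apply: (@measurable_lipschitz_sublevel _ _ _ _
    (fun i w => f (i%:R / n%:R) + eps i w) (fun a => s_ n j (pcfun a))).
    by move=> i; exact: measurable_funD.
  by move=> a b; exact: s_pcfun_lipschitz.
move=> w /= sY; apply: contrapT => nEw; move: sY; apply/negP; rewrite -leNgt.
(* [s_le_add] bounds the value at its first argument, which has to be [fn]; hence the noise enters
   with a minus sign. *)
have dKle : (dK fn (Yn w) <= tau_%:E)%E.
  have [[[Lf _] _] _] := pcfunP (fun i : 'I_n => f (i%:R / n%:R)) hn.
  have [[[LY _] _] YE] := PCY w.
  apply: (@dK_le_grid _ n _ _ (fun i => - eps i w)) => //.
    by move=> i t it; rewrite /fn /Yn (fnE i t it) (YE i t it); ring.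
  by move=> m mn; rewrite sumrN normrN; exact: hE.
have [[Lf _] _] := PCfn; have [[[LY _] _] _] := PCY w.
have := s_le_add n j Lf LY dKle.
case: (s_ n j (Yn w)) => [y||]; last 2 first.
- by move=> _; rewrite leey.
- by rewrite addeNy leeNy_eq => /eqP sfn'; move: sfn; rewrite sfn'.
move=> /(le_trans sfn); rewrite -EFinD !lee_fin; lra.
Qed.
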